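(* Let $\mathcal{G}_1$ be an $r_1$-regular graph of order $n_1$ with Laplacian eigenvalues $\gamma_{11},\ldots,\gamma_{1n_1}$, and let $\mathcal{G}_2$ be an arbitrary graph of order $n_2$ with Laplacian eigenvalues $\gamma_{21},\ldots,\gamma_{2n_2}$. Then the Laplacian characteristic polynomial of $\mathcal{G}_1\boxtimes\mathcal{G}_2$ is $$f(\mathcal{L}_{\mathcal{G}_1\boxtimes\mathcal{G}_2},x)=\prod_{i=1}^{n_2}\big(x-(r_1+1)-\gamma_{2i}\big)^{n_1}\cdot\prod_{i=1}^{n_1}\Big[x-n_2(r_1+1)-\gamma_{1i}-\chi_{\mathcal{L}_{\mathcal{G}_2}}\big(x-(r_1+1)\big)(r_1+1-\gamma_{1i})^2\Big].$$
   Context: All graphs are finite, simple and undirected. For graphs $\mathcal{G}_1$ (vertices $u_1,\ldots,u_{n_1}$) and $\mathcal{G}_2$, the closed neighborhood corona $\mathcal{G}_1\boxtimes\mathcal{G}_2$ is obtained from $\mathcal{G}_1$ and $n_1$ disjoint copies of $\mathcal{G}_2$ by joining every vertex of the $i$-th copy to $u_i$ and to every neighbor of $u_i$ in $\mathcal{G}_1$, for each $i$. The Laplacian matrix is $\mathcal{L}_{\mathcal{G}}=\mathcal{D}_{\mathcal{G}}-\mathcal{A}_{\mathcal{G}}$ (degree matrix minus adjacency matrix). For a square matrix $M$ of order $n$, its coronal is the rational function $\chi_M(x)=\mathbf{1}_n^T(xI_n-M)^{-1}\mathbf{1}_n$ with $\mathbf{1}_n$ the all-ones vector, and $f(M,x)=\det(xI-M)$.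 *)

(* Defs.v *)
From HB Require Import structures.
From mathcomp Require Import all_boot all_order all_algebra.

Set Implicit Arguments.
Unset Strict Implicit.
Unset Printing Implicit Defensive.

Import GRing.Theory.
Local Open Scope ring_scope.

Record sgraph := SGraph {
  vertex :> finType;
  adj : rel vertex;
  adj_sym : symmetric adj;
  adj_irr : irreflexive adj
}.

Definition degree (G : sgraph) (u : G) : nat := #|[set v : G | adj u v]|.

Definition regular (G : sgraph) (r : nat) : Prop := forall u : G, degree u = r.

Section Corona.
Variables G1 G2 : sgraph.

(* [inl u] is the vertex u of G1; [inr (u, a)] is the vertex a of the copy of
   G2 attached to u. *)
Definition corona_adj : rel (G1 + G1 * G2)%type := fun p q =>
  match p, q with
  | inl u, inl v => adj u v
  | inl v, inr (u, _) | inr (u, _), inl v => (v == u) || adj u v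
  | inr (u, a), inr (v, b) => (u == v) && adj a b
  end.

Lemma corona_adj_sym : symmetric corona_adj.
Proof.
move=> [u|[u a]] [v|[v b]] //=; first exact: adj_sym.
by rewrite eq_sym (adj_sym a).
Qed.

Lemma corona_adj_irr : irreflexive corona_adj.
Proof. by move=> [u|[u a]] /=; rewrite adj_irr ?andbF. Qed.

Definition closed_nbhd_corona : sgraph :=
  SGraph corona_adj_sym corona_adj_irr.

End Corona.

Section Matrices.
Variable R : comNzRingType.

(* Rows and columns follow the enumeration [enum_val] of the vertices. *)
Definition degree_mx (G : sgraph) : 'M[R]_#|G| :=
  diag_mx (\row_i (degree (enum_val i : G))%:R).

Definition adjacency_mx (G : sgraph) : 'M[R]_#|G| :=
  \matrix_(i, j) (adj (enum_val i : G) (enum_val j))%:R.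

Definition laplacian (G : sgraph) : 'M[R]_#|G| :=
  degree_mx G - adjacency_mx G.

(* [g] lists the eigenvalues of [M] with algebraic multiplicity. *)
Definition eigenvalues_of (m n : nat) (M : 'M[R]_m) (g : 'I_n -> R) : Prop :=
  char_poly M = \prod_(i < n) ('X - (g i)%:P).

End Matrices.

Section Coronal.
Variable R : fieldType.

Definition ratfun_const (c : R) : {fraction {poly R}} := tofrac c%:P.

(* The coronal of [M] with the rational function [y] substituted for the
   variable.  [invmx] is a true inverse here for every nonconstant [y], since
   [det (y I - M)] is a nonzero polynomial over R evaluated at an element
   transcendental over R. *)
Definition coronal (n : nat) (M : 'M[R]_n) (y : {fraction {poly R}}) :
    {fraction {poly R}} :=
  ((const_mx 1 : 'rV_n) *m invmx (y%:M - map_mx ratfun_const M)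
     *m (const_mx 1 : 'cV_n)) 0 0.

End Coronal.

(* Main.v *)
(** List the vertices of G1 first, then the copies of G2 one after the other,
    and write N = (r1 + 1) I - L1 = I + A1 and B = (x - (r1 + 1)) I - L2.  With #
    the Kronecker product, the matrix x I - L of the corona is the block matrix
      [ (x - n2 (r1 + 1)) I - L1   N # 1^T ]
      [ N # 1                      I # B   ].
    The Schur complement of I # B is (x - n2 (r1 + 1)) I - L1 - chi N^2, with
    chi = 1^T B^-1 1 the coronal; it is a quadratic polynomial in L1, and its
    determinant is the product of the values of that polynomial at the
    eigenvalues of L1. *)

Require Import Defs.
From HB Require Import structures.
From mathcomp Require Import all_boot all_order all_algebra.
From mathcomp Require Import perm ring.

Set Implicit Arguments.
Unset Strict Implicit.
Unset Printing Implicit Defensive.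

Import GRing.Theory.
Local Open Scope ring_scope.

(** * Determinants under reindexing and of block matrices *)

Lemma det_mxsub_bij (R : comNzRingType) (m n : nat) (f : 'I_m -> 'I_n)
    (A : 'M[R]_n) :
  bijective f -> \det (mxsub f f A) = \det A.
Proof.
move=> bij_f; have eq_mn : m = n.
  by have /= := bij_eq_card bij_f; rewrite !card_ord.
subst m; have inj_f := bij_inj bij_f.
(* The same permutation acts on rows and columns, so its sign enters twice and cancels. *)
have -> : mxsub f f A = row_perm (perm inj_f) (col_perm (perm inj_f) A).
  by apply/matrixP=> i j; rewrite !mxE !permE.
rewrite row_permE col_permE !det_mulmx !det_perm mulrCA odd_permV -signr_addb.
by rewrite addbb mulr1.
Qed.

(** Right multiplication by a unit lower triangular matrix with block [- W] clears the lower left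
    block. Taking [W] as a solution of [B *m W = V] keeps inverses out of the statement and lets [W]
    be given block by block. *)
Lemma det_block_schur (R : comNzRingType) (m n : nat) (A : 'M[R]_m)
    (U : 'M_(m, n)) (V : 'M_(n, m)) (B : 'M_n) (W : 'M_(n, m)) :
  B *m W = V -> \det (block_mx A U V B) = \det B * \det (A - U *m W).
Proof.
move=> BW; pose E : 'M[R]_(m + n) := block_mx 1%:M 0 (- W) 1%:M.
have detE : \det E = 1 by rewrite det_lblock !det1 mulr1.
rewrite -[LHS]mulr1 -detE -det_mulmx mulmx_block.
by rewrite !mulmx1 !mulmx0 !add0r !mulmxN BW subrr det_ublock mulrC.
Qed.

Lemma det_castmx (R : comNzRingType) (m n : nat) (e : m = n) (A : 'M[R]_m) :
  \det (castmx (e, e) A) = \det A.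
Proof. by case: _ / e; rewrite castmx_id. Qed.

Lemma det_mxdiag (R : comNzRingType) (m : nat) (p : 'I_m -> nat)
    (B : forall i, 'M[R]_(p i)) :
  \det (\mxdiag_i B i) = \prod_i \det (B i).
Proof.
elim: m => [|m IHm] in p B *.
  have e : (\sum_i p i)%N = 0 by rewrite big_ord0.
  by rewrite -(det_castmx e) det_mx00 big_ord0.
by rewrite mxdiag_recl det_castmx det_ublock IHm [RHS]big_ord_recl.
Qed.

(** * Determinant of a quadratic polynomial in a matrix *)

Definition quad_mx (R : comNzRingType) (n : nat) (a b c : R) (M : 'M[R]_n) :=
  a%:M + b *: M + c *: (M *m M).

(** Meant for the Schur complement of the corona, with [M] the Laplacian of G1, [k] equal to r1 + 1
    and [t] the coronal. *)
Lemma quad_mx_subsq (R : comNzRingType) (n : nat) (a k t : R) (M : 'M[R]_n) :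
  a%:M - M - t *: ((k%:M - M) *m (k%:M - M)) =
    quad_mx (a - t * k ^+ 2) (2 * t * k - 1) (- t) M.
Proof.
rewrite /quad_mx mulmxBl !mulmxBr -scalar_mxM mul_scalar_mx mul_mx_scalar.
move: (M *m M) => M2; apply/matrixP=> i j; rewrite !mxE.
by case: (i == j); rewrite ?mulr1n ?mulr0n; ring.
Qed.

Lemma det_conj (F : comUnitRingType) (n : nat) (P M : 'M[F]_n) :
  P \in unitmx -> \det (P *m M *m invmx P) = \det M.
Proof.
by move=> uP; rewrite !det_mulmx det_inv mulrAC divrr ?mul1r -?unitmxE.
Qed.

Lemma char_poly_conj (F : fieldType) (n : nat) (P M : 'M[F]_n) :
  P \in unitmx -> char_poly (P *m M *m invmx P) = char_poly M.
Proof.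
move=> uP; have uPX : map_mx (@polyC F) P \in unitmx by rewrite map_unitmx.
rewrite /char_poly -(det_conj (char_poly_mx M) uPX) /char_poly_mx.
rewrite mulmxBr mulmxBl scalar_mxC mulmxK //.
by rewrite !map_mxM /= map_invmx.
Qed.

Lemma quad_mx_conj (F : fieldType) (n : nat) (a b c : F) (P M : 'M[F]_n) :
  P \in unitmx ->
  quad_mx a b c (P *m M *m invmx P) = P *m quad_mx a b c M *m invmx P.
Proof.
move=> uP; rewrite /quad_mx !mulmxDr !mulmxDl -!scalemxAr -!scalemxAl.
rewrite scalar_mxC mulmxK //; congr (_ + _ *: _).
by rewrite !mulmxA mulmxKV.
Qed.

(** In the rank factorisation of [v], the left factor is a nonzero scalar and [pid_mx 1] selects the
    first row of [row_ebase v], which is therefore [v] divided by that scalar. *)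
Lemma unitmx_extend_row (F : fieldType) (n : nat) (v : 'rV[F]_(1 + n)) :
  v != 0 -> exists (P : 'M[F]_(1 + n)) (k : F),
    P \in unitmx /\ usubmx P = k *: v.
Proof.
move=> nz_v; exists (row_ebase v), (col_ebase v 0 0)^-1.
split; first exact: row_ebase_unit.
have uC := col_ebase_unit v.
have nzC : col_ebase v 0 0 != 0.
  by move: uC; rewrite unitmxE det_mx11 unitfE.
rewrite -[X in _ *: X](mulmx_ebase v) rank_rV nz_v -mulmxA.
move: (_ 0 0) (mx11_scalar (col_ebase v)) nzC => k -> nz_k.
rewrite mul_scalar_mx scalerA mulVf // scale1r -[row_ebase v in RHS]vsubmxK.
have -> : pid_mx 1 = row_mx 1%:M 0 :> 'M[F]_(1, 1 + n).
  by rewrite pid_mx_row.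
by rewrite mul_row_col mul1mx mul0mx addr0.
Qed.

(** Eigenvectors here are row vectors: once the first row of [P] is a multiple of one, the first row
    of the conjugate is z followed by zeros. *)
Lemma eigenvalue_conj_lblock (F : fieldType) (n : nat) (M : 'M[F]_(1 + n))
    (z : F) :
  eigenvalue M z ->
  exists (P : 'M[F]_(1 + n)) (w : 'cV[F]_n) (N : 'M[F]_n),
    P \in unitmx /\ P *m M *m invmx P = block_mx z%:M 0 w N.
Proof.
case/eigenvalueP=> v vM nz_v.
have [P [k [uP Pv]]] := unitmx_extend_row nz_v.
set C := P *m M *m invmx P.
have uC : usubmx C = row_mx z%:M 0.
  rewrite /C -!mul_usub_mx Pv -scalemxAl vM scalerA mulrC -scalerA -Pv.
  rewrite -scalemxAl mul_usub_mx mulmxV //.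
  by rewrite scalar_mx_block col_mxKu scale_row_mx scaler0 scalemx1.
exists P, (dlsubmx C), (drsubmx C); split=> //.
by rewrite -[LHS]vsubmxK -/C uC -[dsubmx C]hsubmxK.
Qed.

Lemma char_poly_lblock (F : fieldType) (m n : nat) (A : 'M[F]_m)
    (C : 'M[F]_(n, m)) (B : 'M[F]_n) :
  char_poly (block_mx A 0 C B) = char_poly A * char_poly B.
Proof.
rewrite /char_poly /char_poly_mx map_block_mx map_mx0.
by rewrite scalar_mx_block opp_block_mx add_block_mx oppr0 addr0 det_lblock.
Qed.

Lemma det_quad_mx_lblock (F : fieldType) (m n : nat) (a b c : F) (A : 'M[F]_m)
    (C : 'M[F]_(n, m)) (B : 'M[F]_n) :
  \det (quad_mx a b c (block_mx A 0 C B)) =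
    \det (quad_mx a b c A) * \det (quad_mx a b c B).
Proof.
rewrite /quad_mx mulmx_block !scale_block_mx scalar_mx_block !add_block_mx.
by rewrite !(mulmx0, mul0mx, addr0, add0r, scaler0) det_lblock.
Qed.

(** Triangularisation by induction: conjugation to lower block form splits off one eigenvalue and
    changes neither the characteristic polynomial nor the determinant. *)
Lemma det_quad_mx (F : fieldType) (n : nat) (a b c : F) (M : 'M[F]_n)
    (s : seq F) :
  char_poly M = \prod_(z <- s) ('X - z%:P) ->
  \det (quad_mx a b c M) = \prod_(z <- s) (a + b * z + c * z ^+ 2).
Proof.
elim: n s => [|n IHn] s in M *; move=> chM.
  have := size_char_poly M; rewrite chM size_prod_XsubC.
  by case: s {chM} => // _; rewrite big_nil det_mx00.
have := size_char_poly M; rewrite chM size_prod_XsubC.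
case: s chM => // z s chM _.
have eigz : eigenvalue M z.
  by rewrite eigenvalue_root_char chM root_prod_XsubC inE eqxx.
have [P [w [N [uP PM]]]] := eigenvalue_conj_lblock eigz.
have chN : char_poly N = \prod_(t <- s) ('X - t%:P).
  (* Cancelling X - z leaves [N] with the remaining eigenvalues. *)
  apply: (mulfI (negbT (polyXsubC_eq0 z))).
  transitivity (char_poly M); last by rewrite chM big_cons.
  rewrite -(char_poly_conj M uP) PM (@char_poly_lblock _ 1) /char_poly.
  by rewrite /char_poly_mx map_scalar_mx -raddfB /= det_scalar1.
rewrite big_cons -(IHn _ _ chN) -(det_conj _ uP) -quad_mx_conj // PM.
rewrite (@det_quad_mx_lblock _ 1); congr (_ * _).
by rewrite /quad_mx -scalar_mxM !scale_scalar_mx -!raddfD /= det_scalar1 expr2.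
Qed.

Lemma det_scalarB (R : comNzRingType) (n : nat) (M : 'M[R]_n) (y : R) :
  \det (y%:M - M) = (char_poly M).[y].
Proof.
rewrite -horner_evalE /char_poly -det_map_mx; congr (\det _).
apply/matrixP=> i j; rewrite !mxE /= horner_evalE hornerD hornerN hornerMn.
by rewrite hornerX hornerC.
Qed.

(** * Degrees in the corona *)

Lemma degree_sum (G : sgraph) (u : G) : degree u = (\sum_v adj u v)%N.
Proof.
rewrite /degree -sum1dep_card [LHS]big_mkcond; apply: eq_bigr => v _.
by case: adj.
Qed.

Lemma sum_closed_nbhd (G : sgraph) (u : G) :
  (\sum_v ((v == u) || adj u v))%N = (degree u).+1.
Proof.
rewrite degree_sum (bigD1 u) //= eqxx [in RHS](bigD1 u) //= adj_irr add0n add1n.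
by congr _.+1; apply: eq_bigr => v /negbTE ->.
Qed.

Section CoronaLaplacian.
Variables G1 G2 : sgraph.
Local Notation corona := (closed_nbhd_corona G1 G2).

Lemma degree_corona_inl (u : G1) :
  degree (inl u : corona) = (degree u + #|G2| * (degree u).+1)%N.
Proof.
rewrite degree_sum big_sumType /= -degree_sum; congr (_ + _)%N.
transitivity (\sum_(v : G1) \sum_(a : G2) ((v == u) || adj u v))%N.
  by rewrite pair_big; apply: eq_bigr => -[v a] _; rewrite /= eq_sym adj_sym.
rewrite exchange_big /= -[RHS]sum_nat_const; apply: eq_bigr => a _.
exact: sum_closed_nbhd.
Qed.

Lemma degree_corona_inr (u : G1) (a : G2) :
  degree (inr (u, a) : corona) = ((degree u).+1 + degree a)%N.
Proof.
rewrite degree_sum big_sumType /= sum_closed_nbhd; congr (_ + _)%N.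
transitivity (\sum_(v : G1) \sum_(b : G2) ((u == v) && adj a b))%N.
  by rewrite pair_big; apply: eq_bigr => -[v b] _.
rewrite (bigD1 u) //= [X in (_ + X)%N]big1 => [|v /negbTE neq_vu].
  by rewrite addn0 degree_sum; apply: eq_bigr => b _; rewrite eqxx.
by apply: big1 => b _; rewrite eq_sym neq_vu.
Qed.

(** * Enumeration of the corona's vertices by blocks *)

Local Notation blocks := (#|G1| + \sum_(u < #|G1|) #|G2|)%N.

(** The copies are indexed by a sum of constant sizes because [\mxrow], [\mxcol] and [\mxdiag] index
    their blocks that way. *)
Definition corona_vertex (i : 'I_blocks) : corona :=
  match split i with
  | inl u => inl (enum_val u)
  | inr k => inr (enum_val (tagnat.sig1 k), enum_val (tagnat.sig2 k))
  end.

Lemma corona_vertex_lshift u : corona_vertex (lshift _ u) = inl (enum_val u).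
Proof. by rewrite /corona_vertex -[lshift _ u]/(unsplit (inl u)) unsplitK. Qed.

Lemma corona_vertex_rshift k :
  corona_vertex (rshift _ k) =
    inr (enum_val (tagnat.sig1 k), enum_val (tagnat.sig2 k)).
Proof. by rewrite /corona_vertex -[rshift _ k]/(unsplit (inr k)) unsplitK. Qed.

Lemma corona_vertex_bij : bijective corona_vertex.
Proof.
pose g (p : corona) : 'I_blocks :=
  match p with
  | inl u => lshift _ (enum_rank u)
  | inr (u, a) =>
      rshift _ (@tagnat.Rank _ (fun=> #|G2|) (enum_rank u) (enum_rank a))
  end.
have fK : cancel corona_vertex g.
  move=> i; case: (split_ordP i) => [u|k] ->.
    by rewrite corona_vertex_lshift /g enum_valK.
  by rewrite corona_vertex_rshift /g !enum_valK tagnat.sig2K.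
(* With equal cardinalities, a left inverse suffices. *)
apply: inj_card_bij (can_inj fK) _.
by rewrite card_sum card_prod card_ord sum_nat_const card_ord.
Qed.

(** * Block form and determinant of the corona Laplacian *)

Variable K : fieldType.

Lemma laplacianE (G : sgraph) i j :
  laplacian K G i j =
    (degree (enum_val i))%:R *+ (i == j) - (adj (enum_val i) (enum_val j))%:R.
Proof. by rewrite !mxE. Qed.

Variable r : nat.
Hypothesis regular1 : regular G1 r.
Variable y : K.
Local Notation L1 := (laplacian K G1).
Local Notation L2 := (laplacian K G2).
Let N : 'M[K]_#|G1| := (r + 1)%:R%:M - L1.
Let B : 'M[K]_#|G2| := (y - (r + 1)%:R)%:M - L2.

(** Regularity makes the diagonal of [L1] constantly r, so [N] is I + A1, the matrix that governs
    the joins between G1 and the copies. *)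
Lemma regular_closed_nbhd i j :
  N i j = ((enum_val j == enum_val i) || adj (enum_val i) (enum_val j))%:R.
Proof.
rewrite /N mxE mxE mxE laplacianE regular1 (inj_eq enum_val_inj) eq_sym.
case: eqVneq => [->|_]; last by rewrite !mulr0n !sub0r opprK.
by rewrite adj_irr !mulr1n subr0 natrD addrAC subrr add0r.
Qed.

(** The Kronecker products of [N] with all-ones vectors appear as rows and columns of rank-one
    blocks. They carry a plus sign, as the off-diagonal entries of yI - L are those of the adjacency
    matrix. *)
Lemma corona_laplacian_blocks :
  mxsub (enum_rank \o corona_vertex) (enum_rank \o corona_vertex)
    (y%:M - laplacian K corona) =
  block_mx ((y - (#|G2| * (r + 1))%:R)%:M - L1)
    (\mxrow_(j < #|G1|) (col j N *m (const_mx 1 : 'rV_#|G2|)))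
    (\mxcol_(i < #|G1|) ((const_mx 1 : 'cV_#|G2|) *m row i N))
    (\mxdiag_(i < #|G1|) B).
Proof.
apply/matrixP=> i j; rewrite [LHS]mxE.
rewrite [LHS]mxE [X in X + _]mxE [X in _ + X]mxE laplacianE /=.
rewrite !enum_rankK (inj_eq enum_rank_inj).
case: (split_ordP i) => [u|k] ->; case: (split_ordP j) => [v|l] ->;
  rewrite ?corona_vertex_lshift ?corona_vertex_rshift.
- rewrite block_mxEul [RHS]mxE [X in _ = X + _]mxE [X in _ = _ + X]mxE.
  rewrite laplacianE degree_corona_inl regular1 /=.
  rewrite (inj_eq (@inl_inj _ _)) (inj_eq enum_val_inj) -addn1.
  case: eqVneq => _; rewrite ?mulr1n ?mulr0n ?sub0r //.
  by rewrite natrD; ring.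
- rewrite block_mxEur mxE mxE big_ord1 [X in _ = X * _]mxE.
  rewrite [X in _ = _ * X]mxE mulr1 regular_closed_nbhd /=.
  by rewrite !mulr0n !sub0r opprK eq_sym adj_sym.
- rewrite block_mxEdl mxE mxE big_ord1 [X in _ = X * _]mxE.
  rewrite [X in _ = _ * X]mxE mul1r regular_closed_nbhd /=.
  by rewrite !mulr0n !sub0r opprK.
(* Distinct copies are not adjacent; within one copy every degree grows by r + 1, which is the shift
   in [B]. *)
rewrite block_mxEdr mxE conform_mx_id degree_corona_inr regular1 /=.
rewrite (inj_eq (@inr_inj _ _)) xpair_eqE !(inj_eq enum_val_inj).
case: eqVneq => _ /=; last by rewrite mxE !mulr0n !sub0r !oppr0.
rewrite [RHS]mxE [X in _ = X + _]mxE [X in _ = _ + X]mxE laplacianE -addn1.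
case: eqVneq => _; rewrite ?mulr1n ?mulr0n ?sub0r //.
by rewrite natrD; ring.
Qed.

Lemma det_corona_laplacian :
    B \in unitmx ->
  let chi :=
    ((const_mx 1 : 'rV_#|G2|) *m invmx B *m (const_mx 1 : 'cV_#|G2|)) 0 0 in
  \det (y%:M - laplacian K corona) =
    \det B ^+ #|G1| *
    \det ((y - (#|G2| * (r + 1))%:R)%:M - L1 - chi *: (N *m N)).
Proof.
move=> uB chi.
have bij_f : bijective (enum_rank \o corona_vertex).
  exact: bij_comp (@enum_rank_bij _) corona_vertex_bij.
rewrite -(det_mxsub_bij _ bij_f) corona_laplacian_blocks.
(* The blockwise solution of diag(B) W = V. *)
pose W := \mxcol_(i < #|G1|) (invmx B *m ((const_mx 1 : 'cV_#|G2|) *m row i N)).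
rewrite (@det_block_schur _ _ _ _ _ _ _ W); last first.
  by rewrite /W mul_mxdiag_mxcol; apply: eq_mxcol => i; rewrite mulKVmx.
rewrite det_mxdiag prodr_const card_ord; congr (_ * \det (_ - _)).
rewrite /W mul_mxrow_mxcol.
(* The inner factor 1^T B^-1 1 is a 1 by 1 matrix, hence the scalar [chi]; the remaining outer
   products of columns and rows of [N] add up to [N *m N]. *)
transitivity (\sum_i chi *: (col i N *m row i N)).
  apply: eq_bigr => i _; rewrite !mulmxA -2!(mulmxA (col i N)).
  by rewrite [_ *m const_mx 1]mx11_scalar -/chi mul_mx_scalar -scalemxAl.
rewrite -scaler_sumr; congr (_ *: _).
apply/matrixP=> i j; rewrite summxE !mxE; apply: eq_bigr => k _.
by rewrite mxE big_ord1 mxE [X in _ * X = _]mxE.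
Qed.

End CoronaLaplacian.

(** * Passage to rational functions and conclusion *)

Lemma map_laplacian (R S : comNzRingType) (f : {rmorphism R -> S})
    (G : sgraph) : map_mx f (laplacian R G) = laplacian S G.
Proof.
by apply/matrixP=> i j; rewrite !mxE rmorphB rmorphMn /= !rmorph_nat.
Qed.

Theorem theorem2 (R : rcfType) (G1 G2 : sgraph) (n1 n2 r1 : nat)
    (order1 : #|G1| = n1) (order2 : #|G2| = n2)
    (regular1 : regular G1 r1)
    (g1 : 'I_n1 -> R) (g2 : 'I_n2 -> R)
    (eig1 : eigenvalues_of (laplacian R G1) g1)
    (eig2 : eigenvalues_of (laplacian R G2) g2) :
  let x : {fraction {poly R}} := tofrac 'X in
  tofrac (char_poly (laplacian R (closed_nbhd_corona G1 G2))) =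
    (\prod_(i < n2) (x - (r1 + 1)%:R - ratfun_const (g2 i)) ^+ n1) *
    (\prod_(i < n1)
       (x - (n2 * (r1 + 1))%:R - ratfun_const (g1 i)
        - coronal (laplacian R G2) (x - (r1 + 1)%:R)
          * ((r1 + 1)%:R - ratfun_const (g1 i)) ^+ 2)).
Proof.
subst n1 n2 => x; set chi := coronal _ _.
(* All determinants are computed over the field of rational functions, where the indeterminate [x]
   is an ordinary element; Laplacians have integer entries and so are preserved by the embedding
   [c]. *)
pose K : fieldType := {fraction {poly R}}.
pose c : {rmorphism R -> K} := @tofrac {poly R} \o @polyC R.
have char_poly_map G n (g : 'I_n -> R) : eigenvalues_of (laplacian R G) g ->
    char_poly (laplacian K G) =
      \prod_(z <- [seq c (g i) | i : 'I_n]) ('X - z%:P).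
  move=> eig; rewrite -(map_laplacian c) -map_char_poly eig rmorph_prod.
  rewrite big_image.
  by apply: eq_bigr => i _; rewrite /= map_polyXsubC.
have detB : \det ((x - (r1 + 1)%:R)%:M - laplacian K G2) =
    \prod_(i < #|G2|) (x - (r1 + 1)%:R - ratfun_const (g2 i)).
  rewrite det_scalarB (char_poly_map _ _ _ eig2) big_image horner_prod.
  by apply: eq_bigr => i _; rewrite hornerXsubC.
(* Each factor of the determinant is the image of a monic linear polynomial, hence nonzero. *)
have unitB : (x - (r1 + 1)%:R)%:M - laplacian K G2 \in unitmx.
  rewrite unitmxE unitfE detB; apply/prodf_neq0 => i _.
  have -> : x - (r1 + 1)%:R - ratfun_const (g2 i) =
      tofrac ('X - ((r1 + 1)%:R + g2 i)%:P).
    by rewrite -(rmorph_nat c) polyCD opprD addrA !tofracB.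
  by rewrite tofrac_eq0 polyXsubC_eq0.
have charE : tofrac (char_poly (laplacian R (closed_nbhd_corona G1 G2))) =
    \det (x%:M - laplacian K (closed_nbhd_corona G1 G2)).
  rewrite /char_poly -det_map_mx -(map_laplacian c); congr (\det _).
  by apply/matrixP=> i j; rewrite !mxE rmorphB rmorphMn.
have chiE : chi = ((const_mx 1 : 'rV_#|G2|) *m
    invmx ((x - (r1 + 1)%:R)%:M - laplacian K G2) *m
    (const_mx 1 : 'cV_#|G2|)) 0 0.
  by rewrite /chi /coronal -(map_laplacian c).
rewrite charE (det_corona_laplacian regular1 unitB) -chiE detB.
rewrite prodrXl; congr (_ * _).
set k : K := (r1 + 1)%:R; set m : K := (#|G2| * _)%:R.
(* At an eigenvalue z of L1 the quadratic takes the value x - m - z - chi (k - z)^2. *)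
rewrite quad_mx_subsq (det_quad_mx _ _ _ (char_poly_map _ _ _ eig1)) big_image.
apply: eq_bigr => i _; rewrite -[c (g1 i)]/(ratfun_const (g1 i)); ring.
Qed.
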